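(* Let $p$ be a prime, let $f:\mathbb{Z}_p^n\to\mathbb{C}$ have Fourier degree at most $d$ (where $d\ge0$ is an integer) and $\|f\|_2=1$, let $k\ge 2$ be an integer and let $\epsilon>0$. If the $k$-th Gowers norm of $f$ satisfies $\|f\|_{U^k}>\epsilon$, then there exists a multi-index $\sigma\in\mathbb{Z}_p^n$ such that $$|\hat f(\sigma)|\ge\left(\frac{\epsilon}{(2^k\sqrt{p-1})^{3d}}\right)^{2^k},$$ where the Fourier coefficient is with respect to the standard Fourier basis. In particular, $$\|f\|_{U^2}\ge\left(\frac{\epsilon}{(2^k\sqrt{p-1})^{3d}}\right)^{2^k}.$$
   Context: $\mathbb{Z}_p^n$ carries the uniform probability measure; $\|f\|_2=(\mathbb{E}_X|f(X)|^2)^{1/2}$. Standard Fourier basis: $\chi_\sigma(x)=\exp\left(2\pi i\sum_{j=1}^n\sigma_jx_j/p\right)$ for $\sigma\in\mathbb{Z}_p^n$, and $\hat f(\sigma)=\mathbb{E}_X[f(X)\overline{\chi_\sigma(X)}]$. Let $|\sigma|$ be the number of coordinates $j$ with $\sigma_j\neq0$. $f$ has Fourier degree at most $d$ if $\hat f(\sigma)=0$ whenever $|\sigma|>d$. Gowers norm: for $Y\in\mathbb{Z}_p^n$ let $f_Y(X)=f(X+Y)\overline{f(X)}$, and recursively $f_{Y_1,\dots,Y_m}=(f_{Y_1,\dots,Y_{m-1}})_{Y_m}$. The $m$-th Gowers norm $\|f\|_{U^m}$ is defined by $\|f\|_{U^m}^{2^m}=\mathbb{E}[f_{Y_1,\dots,Y_m}(X)]$,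 where $X,Y_1,\dots,Y_m$ are independent and uniform in $\mathbb{Z}_p^n$. *)

(* Defs.v *)
From mathcomp Require Import all_boot all_order all_algebra.
From mathcomp Require Export complex.
From mathcomp Require Import reals trigo.
Set Implicit Arguments.
Unset Strict Implicit.
Unset Printing Implicit Defensive.
Import Order.TTheory GRing.Theory Num.Theory.
Local Open Scope ring_scope.

(* For p prime, Z_p^n is the type 'rV['F_p]_n; complex numbers are R[i] for a
   realType R.  Norms are elements of R[i]: a <= b and a < b on R[i] mean that
   b - a is a nonnegative (resp. positive) real number. *)

Definition expect (R : realType) (T : finType) (F : T -> R[i]) : R[i] :=
  (\sum_x F x) / #|T|%:R.

(* exp(i t) *)
Definition cis (R : realType) (t : R) : R[i] := Complex (cos t) (sin t).

(* The coordinates are read through their representatives in {0, ..., p-1}. *)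
Definition chi (R : realType) (p n : nat) (sigma x : 'rV['F_p]_n) : R[i] :=
  cis (2 * pi * (\sum_(j < n) (sigma 0 j : nat)%:R * (x 0 j : nat)%:R) / p%:R).

Definition fourier (R : realType) (p n : nat) (f : 'rV['F_p]_n -> R[i])
    (sigma : 'rV['F_p]_n) : R[i] :=
  expect (fun x => f x * conjc (chi R sigma x)).

Definition weight (p n : nat) (sigma : 'rV['F_p]_n) : nat :=
  #|[set j | sigma 0 j != 0]|.

Definition fourier_degree_le (R : realType) (p n d : nat)
    (f : 'rV['F_p]_n -> R[i]) : Prop :=
  forall sigma, (d < weight sigma)%N -> fourier f sigma = 0.

Definition l2norm (R : realType) (p n : nat) (f : 'rV['F_p]_n -> R[i]) : R[i] :=
  sqrtC (expect (fun x => `|f x| ^+ 2)).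

Definition mulderiv (R : realType) (p n : nat) (f : 'rV['F_p]_n -> R[i])
    (Y : 'rV['F_p]_n) : 'rV['F_p]_n -> R[i] :=
  fun X => f (X + Y) * conjc (f X).

(* [foldl (@mulderiv R p n) f [:: Y_1; ...; Y_m]] is f_{Y_1, ..., Y_m}. *)
Definition gowers_avg (R : realType) (p n m : nat)
    (f : 'rV['F_p]_n -> R[i]) : R[i] :=
  expect (fun XY : 'rV['F_p]_n * m.-tuple 'rV['F_p]_n =>
    foldl (@mulderiv R p n) f XY.2 XY.1).

(* For 1 <= m the average is a nonnegative real, and [k.-root] of such a number
   is its nonnegative real k-th root. *)
Definition gowers (R : realType) (p n m : nat)
    (f : 'rV['F_p]_n -> R[i]) : R[i] :=
  (2 ^ m)%N.-root (gowers_avg m f).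

(* Main.v *)
Require Import Defs.
From mathcomp Require Import all_boot all_order all_algebra.
From mathcomp Require Import reals.
From mathcomp Require Import trigo ring lra.
Import Order.TTheory GRing.Theory Num.Theory.
Local Open Scope ring_scope.
Local Open Scope complex_scope.

(* Expanding every factor of the Gowers average in characters gives a sum, over
   tuples of frequencies subject to linear constraints, of products of Fourier
   coefficients.  Replace each coefficient by its absolute value, except that
   those of the factor at the empty set are all replaced by M = max |hat f|:
   this factor becomes M times the indicator function of 0, so the average is
   at most M * E_Y prod_(S nonempty) |F(sum_(i in S) Y_i)| with
   F = sum_sigma |hat f(sigma)| chi_sigma.  By AM-GM this is at most
   M * max(1, E |F|^q), q = 2^k.  As F has degree at most d and norm 1,
   hypercontractivity bounds E |F|^q by K^(dq / 2) with K = q^2 (p - 1), which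
   is better than required.  For the U^2 norm,
   |hat f(sigma)|^2 = E_(X,Y) f_Y(X) conj(chi_sigma(Y)), and Cauchy-Schwarz in
   Y gives |hat f(sigma)|^4 <= |f|_(U^2)^4. *)

Set Implicit Arguments.
Unset Strict Implicit.
Unset Printing Implicit Defensive.

(** * Real inequalities: Cauchy-Schwarz, Minkowski and a tangent bound for powers *)

Lemma sum_cauchy_schwarz (R : realFieldType) (T : finType) (u v : T -> R) :
  (\sum_x u x * v x) ^+ 2 <= (\sum_x u x ^+ 2) * (\sum_x v x ^+ 2).
Proof.
have -> : (\sum_x u x * v x) ^+ 2 = \sum_x \sum_y (u x * v x) * (u y * v y).
  by rewrite expr2 mulr_suml; apply: eq_bigr => x _; rewrite mulr_sumr.
have E1 : (\sum_x u x ^+ 2) * (\sum_x v x ^+ 2)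
    = \sum_x \sum_y u x ^+ 2 * v y ^+ 2.
  by rewrite mulr_suml; apply: eq_bigr => x _; rewrite mulr_sumr.
have E2 : (\sum_x u x ^+ 2) * (\sum_x v x ^+ 2)
    = \sum_x \sum_y u y ^+ 2 * v x ^+ 2.
  by rewrite E1 exchange_big.
(* After doubling, the difference of the two sides is the sum of the squares of
   [u x * v y - u y * v x]. *)
suff : 2 * (\sum_x \sum_y (u x * v x) * (u y * v y))
    <= (\sum_x u x ^+ 2) * (\sum_x v x ^+ 2)
       + (\sum_x u x ^+ 2) * (\sum_x v x ^+ 2) by lra.
rewrite {1}E1 E2 -big_split mulr_sumr; apply: ler_sum => x _.
rewrite -big_split mulr_sumr; apply: ler_sum => y _ /=.
by have := sqr_ge0 (u x * v y - u y * v x); nra.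
Qed.

(* The triangle inequality in L^(2^j), by squaring: apply the induction
   hypothesis to the family [u l * u l'], controlled by Cauchy-Schwarz. *)
Lemma sum_minkowski (R : realFieldType) (T L : finType) (j : nat) (W : R)
    (u : L -> T -> R) (c : L -> R) :
    0 <= W -> (forall l x, 0 <= u l x) -> (forall l, 0 <= c l) ->
    (forall l, \sum_x u l x ^+ (2 ^ j) <= W * c l ^+ (2 ^ j)) ->
  \sum_x (\sum_l u l x) ^+ (2 ^ j) <= W * (\sum_l c l) ^+ (2 ^ j).
Proof.
move=> W0; elim: j L u c => [|j IH] L u c u0 c0 H.
  rewrite expn0 expr1 exchange_big mulr_sumr; apply: ler_sum => l _.
  by have := H l.
have sq (S : finType) (a : S -> R) :
    (\sum_l a l) ^+ 2 = \sum_(l : S * S) a l.1 * a l.2.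
  rewrite expr2 mulr_suml -(pair_bigA _ (fun l l' => a l * a l')) /=.
  by apply: eq_bigr => l _; rewrite mulr_sumr.
rewrite expnS exprM sq.
under eq_bigr => x _ do rewrite exprM sq.
apply: (IH _ (fun l x => u l.1 x * u l.2 x) (fun l => c l.1 * c l.2)).
- by move=> l x; rewrite mulr_ge0.
- by move=> l; rewrite mulr_ge0.
move=> [l l'] /=.
have c2 : 0 <= W * (c l * c l') ^+ (2 ^ j).
  by rewrite mulr_ge0 // exprn_ge0 // mulr_ge0.
rewrite -[leLHS]ger0_norm ?sumr_ge0 // => [|x _]; last first.
  by rewrite exprn_ge0 // mulr_ge0.
rewrite -[leRHS]ger0_norm // -ler_sqr ?nnegrE // !real_normK ?num_real //.
under eq_bigr => x _ do rewrite exprMn.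
apply: (le_trans (sum_cauchy_schwarz _ _)).
under eq_bigr => x _ do rewrite -exprM mulnC -expnS.
under [X in _ * X]eq_bigr => x _ do rewrite -exprM mulnC -expnS.
rewrite expr2 exprMn.
have -> : W * (c l ^+ (2 ^ j) * c l' ^+ (2 ^ j)) * (W * (c l ^+ (2 ^ j) * c l' ^+ (2 ^ j)))
   = (W * c l ^+ (2 ^ j.+1)) * (W * c l' ^+ (2 ^ j.+1)).
  by rewrite expnSr !exprM; ring.
by apply: ler_pM => //; apply: sumr_ge0 => x _; rewrite exprn_ge0.
Qed.

(* Induction on [m]: multiplying by [X + v], the quadratic term [l * v ^+ 2] is
   absorbed by [Y ^+ m * (Y - X)]. *)
Lemma exprD_tangent (R : realFieldType) (X Y h : R) (m : nat) :
    0 <= X -> X <= Y -> 0 <= h -> m%:R * h <= Y * (Y - X) ->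
  exists2 l, 0 <= l <= m%:R * Y ^+ m.-1 &
    forall v, 0 <= X + v -> v ^+ 2 <= h -> (X + v) ^+ m <= Y ^+ m + l * v.
Proof.
move=> X0 XY h0; have Y0 : 0 <= Y := le_trans X0 XY.
elim: m => [|m IH] H.
  by exists 0; rewrite ?mul0r ?lexx // => v _ _; rewrite mul0r addr0.
have Hm : m%:R * h <= Y * (Y - X).
  by apply: le_trans H; rewrite ler_wpM2r // ler_nat.
have [l /andP[l0 lY] Hl] := IH Hm.
have lX : l * X <= m%:R * Y ^+ m.
  case: m lY {IH H Hm Hl} => [|m] lY.
    have -> : l = 0 by apply/eqP; rewrite eq_le l0 andbT -(mul0r (Y ^+ 0)).
    by rewrite !mul0r.
  by rewrite [Y ^+ _]exprSr mulrA; apply: ler_pM.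
(* This is the coefficient of [v] in [(Y ^+ m + l * v) * (X + v)]. *)
exists (Y ^+ m + l * X).
  rewrite addr_ge0 ?exprn_ge0 ?mulr_ge0 //= -natr1 mulrDl mul1r addrC.
  by rewrite lerD2r.
move=> v Xv vh; rewrite exprSr.
apply: (le_trans (ler_wpM2r Xv (Hl v Xv vh))).
have lv : l * v ^+ 2 <= Y ^+ m * (Y - X).
  case: m lY H {IH Hm Hl lX} => [|m] /= lY H.
    have -> : l = 0 by apply/eqP; rewrite eq_le l0 andbT -(mul0r (Y ^+ 0)).
    by rewrite mul0r mulr_ge0 ?subr_ge0 ?exprn_ge0.
  apply: (le_trans (ler_pM l0 (sqr_ge0 v) lY vh)).
  rewrite exprSr -!mulrA mulrCA ler_wpM2l ?exprn_ge0 //.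
  by apply: le_trans H; rewrite ler_wpM2r // ler_nat.
have -> : Y ^+ m.+1 = Y ^+ m * (Y - X) + Y ^+ m * X by rewrite exprSr; ring.
nra.
Qed.

(** * Big operators over tuples *)

Lemma big_tuple_cons (R : Type) (idx : R) (op : Monoid.com_law idx)
    (T : finType) (n : nat) (F : n.+1.-tuple T -> R) :
  \big[op/idx]_t F t
    = \big[op/idx]_x \big[op/idx]_(t : n.-tuple T) F (cons_tuple x t).
Proof.
rewrite (pair_bigA _ (fun x (t : n.-tuple T) => F (cons_tuple x t))) /=.
rewrite (reindex (fun u : T * n.-tuple T => cons_tuple u.1 u.2)) //.
exists (fun t : n.+1.-tuple T => (thead t, behead_tuple t)) => [[x t]|t] _ /=.
  by congr pair; apply: val_inj.
by apply: val_inj; rewrite [in RHS](tuple_eta t).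
Qed.

Lemma big_tuple0 (R : Type) (idx : R) (op : Monoid.com_law idx) (T : finType)
    (F : 0.-tuple T -> R) :
  \big[op/idx]_t F t = F [tuple].
Proof.
by rewrite (bigD1 [tuple]) //= big1 ?Monoid.mulm1 // => t /eqP[]; apply: tuple0.
Qed.

(** * Squared moduli and hypercontractive systems *)

(** Valued in [R], so that moments are compared in a real field rather than in [R[i]]. *)
Definition sqnorm (R : realType) (z : R[i]) : R :=
  complex.Re z ^+ 2 + complex.Im z ^+ 2.

Section SquaredNorm.
Variable R : realType.
Implicit Types z w : R[i].

Lemma sqnorm_ge0 z : 0 <= sqnorm z.
Proof. by rewrite addr_ge0 ?sqr_ge0. Qed.

Lemma sqnormM z w : sqnorm (z * w) = sqnorm z * sqnorm w.
Proof. by case: z w => [a b] [c d]; rewrite /sqnorm /=; ring. Qed.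

Lemma sqnorm_conj z : sqnorm (conjc z) = sqnorm z.
Proof. by case: z => a b; rewrite /sqnorm /= sqrrN. Qed.

Lemma normr_sqnorm z : `|z| ^+ 2 = (sqnorm z)%:C.
Proof. by case: z => a b; rewrite sqr_normc; simpc; rewrite /sqnorm /=; congr Complex; ring. Qed.

Lemma sqnorm_real (a : R) : sqnorm a%:C = a ^+ 2.
Proof. by rewrite /sqnorm /= expr0n addr0. Qed.

Lemma Re_sum (I : finType) (P : pred I) (F : I -> R[i]) :
  complex.Re (\sum_(i | P i) F i) = \sum_(i | P i) complex.Re (F i).
Proof. by apply: (big_morph _ _ (erefl _)) => -[a b] [c d]. Qed.

Lemma Im_sum (I : finType) (P : pred I) (F : I -> R[i]) :
  complex.Im (\sum_(i | P i) F i) = \sum_(i | P i) complex.Im (F i).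
Proof. by apply: (big_morph _ _ (erefl _)) => -[a b] [c d]. Qed.

Lemma sqnorm_sum_le (I : finType) (P : pred I) (F : I -> R[i]) :
  sqnorm (\sum_(i | P i) F i) <= #|P|%:R * \sum_(i | P i) sqnorm (F i).
Proof.
have CS (g : I -> R) :
    (\sum_(i | P i) g i) ^+ 2 <= #|P|%:R * \sum_(i | P i) g i ^+ 2.
  have := sum_cauchy_schwarz (fun i => (P i)%:R) (fun i => if P i then g i else 0).
  congr (_ <= _); first by congr (_ ^+ 2); rewrite [RHS]big_mkcond; apply: eq_bigr => i _;
     case: (P i); rewrite ?mul1r ?mul0r.
  congr (_ * _); last by rewrite [RHS]big_mkcond; apply: eq_bigr => i _;
     case: (P i); rewrite // expr0n.
  rewrite -sum1_card natr_sum [RHS]big_mkcond; apply: eq_bigr => i _.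
  by rewrite [in RHS]unfold_in; case: (P i); rewrite ?expr1n ?expr0n.
by rewrite /sqnorm Re_sum Im_sum (le_trans (lerD (CS _) (CS _))) // -mulrDr big_split.
Qed.

(* The system [phi] satisfies the [(2, 2m)]-hypercontractive inequality with
   constant 1. *)
Definition hypercontractive (m : nat) (J T : finType) (phi : J -> T -> R[i]) :=
  forall a : J -> R[i],
  \sum_x sqnorm (\sum_j a j * phi j x) ^+ m
    <= #|T|%:R * (\sum_j sqnorm (a j)) ^+ m.

(** Splitting off the constant function [phi j0] writes the squared modulus of the sum as
    [A + sqnorm (g x) + v x], where the cross term [v] has mean zero. Bounding the [m]-th power by
    an affine function of [v] therefore leaves only the constant term after summation. *)
Lemma hypercontractive_basis (J T : finType) (j0 : J) (m : nat) (r : R)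
    (phi : J -> T -> R[i]) :
    0 <= r -> (4 * m%:R + 1) * (#|J|%:R * r - r) <= 1 ->
    (forall x, phi j0 x = 1) ->
    (forall j x, j != j0 -> sqnorm (phi j x) <= r) ->
    (forall j, j != j0 -> \sum_x phi j x = 0) ->
  hypercontractive m phi.
Proof.
move=> r0 Hr phi0 phir phis a.
pose A := sqnorm (a j0); pose B := \sum_(j | j != j0) sqnorm (a j).
have A0 : 0 <= A by apply: sqnorm_ge0.
have B0 : 0 <= B by apply: sumr_ge0 => j _; apply: sqnorm_ge0.
have -> : \sum_j sqnorm (a j) = A + B by rewrite (bigD1 j0).
pose e := #|J|%:R * r - r.
have J0 : (0 < #|J|)%N by apply/card_gt0P; exists j0.
have cJ : (#|[pred j | j != j0]|%:R : R) = #|J|%:R - 1.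
  by rewrite -[in RHS](prednK J0) -natr1 addrK; congr _%:R; apply: cardC1.
have e0 : 0 <= e.
  by rewrite /e -[X in _ - X]mul1r -mulrBl mulr_ge0 // subr_ge0 ler1n.
pose g x := \sum_(j | j != j0) a j * phi j x.
have gB x : sqnorm (g x) <= e * B.
  apply: (le_trans (sqnorm_sum_le _ _)).
  have -> : e * B = (#|J|%:R - 1) * (r * B) by rewrite /e; ring.
  rewrite cJ ler_wpM2l -?cJ ?ler0n // mulr_sumr; apply: ler_sum => j jj0.
  by rewrite sqnormM mulrC ler_wpM2r ?sqnorm_ge0 ?phir.
pose v x := 2 * complex.Re (conjc (a j0) * g x).
have sv : \sum_x v x = 0.
  rewrite -mulr_sumr -Re_sum -mulr_sumr /g exchange_big big1 ?mulr0 // => j jj0.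
  by rewrite -mulr_sumr phis // mulr0.
have eqv x : sqnorm (\sum_j a j * phi j x) = A + sqnorm (g x) + v x.
  rewrite (bigD1 j0) //= phi0 mulr1 -/(g x) /A /v /sqnorm.
  by case: (a j0) (g x) => [b c] [b' c'] /=; ring.
have vB x : v x ^+ 2 <= 4 * A * (e * B).
  have : v x ^+ 2 <= 4 * A * sqnorm (g x).
    rewrite /v /A /sqnorm; case: (a j0) (g x) => [b c] [b' c'] /=.
    have := sqr_ge0 (b * c' - c * b'); nra.
  by move/le_trans; apply; rewrite ler_wpM2l // mulr_ge0.
(* By Cauchy-Schwarz [e * B] bounds [sqnorm (g x)], and [4 * A * (e * B)] bounds [v x ^+ 2]. The
   tangent condition reads [m * 4 * A * e * B <= (A + B) * (B - e * B)], which
   [(4 * m + 1) * e <= 1] ensures. *)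
have [||||l _ Hl] := @exprD_tangent R (A + e * B) (A + B) (4 * A * (e * B)) m.
- by rewrite addr_ge0 ?mulr_ge0.
- rewrite lerD2l -[leRHS]mul1r ler_wpM2r //.
  have : 0 <= m%:R * e :> R by rewrite mulr_ge0.
  by move: Hr; rewrite -/e; lra.
- by rewrite !mulr_ge0.
- have : 0 <= (A * B + B * B) * (1 - (4 * m%:R + 1) * e).
    by rewrite mulr_ge0 ?subr_ge0 // addr_ge0 ?mulr_ge0.
  have : 0 <= m%:R * e * (B * B) by rewrite !mulr_ge0.
  rewrite -/e; have : 0 <= e * (A * B) by rewrite !mulr_ge0.
  nra.
have pw x : sqnorm (\sum_j a j * phi j x) ^+ m <= (A + B) ^+ m + l * v x.
  have gx0 : 0 <= A + sqnorm (g x) + v x by rewrite -eqv sqnorm_ge0.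
  have le1 : A + sqnorm (g x) + v x <= A + e * B + v x.
    by rewrite lerD2r lerD2l.
  apply: le_trans (Hl (v x) (le_trans gx0 le1) (vB x)).
  by rewrite eqv lerXn2r // nnegrE // (le_trans gx0).
apply: (le_trans (ler_sum _ (fun x _ => pw x))).
by rewrite big_split /= -mulr_sumr sv mulr0 addr0 sumr_const mulr_natl.
Qed.

(** Tensorization. For each value [t] of the first coordinate, the induction hypothesis handles the
    others with coefficients [b t]; Minkowski then moves the sum over [s'] outside the power mean
    over [t], where the one-coordinate hypothesis applies for each [s']. Minkowski is what restricts
    the exponent to [2 ^ j]. *)
Lemma hypercontractive_tuple (J T : finType) (j n : nat) (phi : J -> T -> R[i]) :
    hypercontractive (2 ^ j) phi ->
  hypercontractive (2 ^ j) (fun (s : n.-tuple J) (x : n.-tuple T) =>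
    \prod_i phi (tnth s i) (tnth x i)).
Proof.
move=> H; elim: n => [|n IH] a.
  by rewrite !big_tuple0 big_ord0 mulr1 card_tuple expn0 mul1r.
rewrite big_tuple_cons exchange_big /= !big_tuple_cons /=.
pose b t s' := \sum_s a (cons_tuple s s') * phi s t.
under eq_bigr => x' _.
  under eq_bigr => t _.
    rewrite big_tuple_cons exchange_big /=.
    under eq_bigr => s' _.
      under eq_bigr => s _ do rewrite big_ord_recl /= !tnth0 mulrA.
      under eq_bigr => s _ do under eq_bigr => i _ do rewrite !tnthS.
      rewrite -mulr_suml -/(b t s'); over.
    over.
  over.
rewrite exchange_big /=.
apply: (le_trans (ler_sum _ (fun t _ => IH (b t)))).
rewrite -mulr_sumr !card_tuple expnSr natrM -mulrA ler_wpM2l ?ler0n //.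
rewrite [X in _ * X ^+ _]exchange_big /=.
apply: (@sum_minkowski R T _ j #|T|%:R (fun s' t => sqnorm (b t s'))).
- by rewrite ler0n.
- by move=> *; apply: sqnorm_ge0.
- by move=> *; apply: sumr_ge0 => *; apply: sqnorm_ge0.
by move=> s'; apply: H.
Qed.

End SquaredNorm.

(** * Characters of Z_p^n, Fourier inversion and Parseval *)

(** Translation by [y] multiplies the sum by [phi y]. The operation is left abstract so as to cover
    [pair_add] as well as ring and vector addition. *)
Lemma sum_multiplicative_eq0 (C : fieldType) (T : finType) (add : T -> T -> T)
    (phi : T -> C) (y : T) :
    injective (add y) -> (forall x, phi (add y x) = phi y * phi x) ->
    phi y != 1 ->
  \sum_x phi x = 0.
Proof.
move=> inj_add phiM phi_neq1; apply/eqP.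
have : (phi y - 1) * \sum_x phi x == 0.
  rewrite mulrBl mul1r subr_eq0 mulr_sumr [eqbRHS](reindex_inj inj_add) /=.
  by apply/eqP; apply: eq_bigr => x _; rewrite phiM.
by rewrite mulf_eq0 subr_eq0 (negbTE phi_neq1).
Qed.

Lemma cisD (R : realType) (x y : R) : cis (x + y) = cis x * cis y.
Proof. by rewrite /cis cosD sinD; simpc; congr Complex; ring. Qed.

Lemma cis0 (R : realType) : cis 0 = 1 :> R[i].
Proof. by rewrite /cis cos0 sin0. Qed.

Lemma cisMn (R : realType) (x : R) n : cis (x *+ n) = cis x ^+ n.
Proof. by elim: n => [|n IH]; rewrite ?mulr0n ?cis0 // mulrSr exprSr cisD IH. Qed.

Lemma sqnorm_cis (R : realType) (x : R) : sqnorm (cis x) = 1.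
Proof. exact: cos2Dsin2. Qed.

Section Characters.
Variables (R : realType) (p : nat).
Hypothesis p_prime : prime p.

Definition e_p (t : 'F_p) : R[i] := cis (2 * pi / p%:R) ^+ (t : nat).

Let root_exp_p : cis (2 * pi / p%:R : R) ^+ p = 1.
Proof.
have p0 : p%:R != 0 :> R by rewrite pnatr_eq0 -lt0n prime_gt0.
rewrite -cisMn -[_ *+ p]mulr_natr divfK // mulr_natl mulr2n cisD.
by rewrite /cis cospi sinpi; simpc.
Qed.

(** The modulus is the one built into the arithmetic of ['F_p]; it equals [p] because [p] is
    prime. *)
Let root_exp_mod k : cis (2 * pi / p%:R : R) ^+ (k %% (Zp_trunc (pdiv p)).+2)
  = cis (2 * pi / p%:R) ^+ k.
Proof. by rewrite Fp_cast // expr_mod // root_exp_p. Qed.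

Lemma e_pD s t : e_p (s + t) = e_p s * e_p t.
Proof. by rewrite /e_p /= root_exp_mod exprD. Qed.

Lemma e_pM (s t : 'F_p) : e_p (s * t) = cis (2 * pi / p%:R) ^+ (s * t)%N.
Proof. by rewrite /e_p /= root_exp_mod. Qed.

Lemma e_p0 : e_p 0 = 1.
Proof. by []. Qed.

Lemma sqnorm_e_p t : sqnorm (e_p t) = 1.
Proof. by rewrite /e_p -cisMn sqnorm_cis. Qed.

(** As [t] is invertible, the primitive root [cis (2 * pi / p)] is a power of [e_p t]. It differs
    from 1 since [2 * pi / p] lies in the interval from 0 to [pi], where the cosine is injective. *)
Lemma e_p_neq1 t : t != 0 -> e_p t != 1.
Proof.
move=> t0; apply/eqP => et1.
have : cis (2 * pi / p%:R : R) = 1.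
  have -> : cis (2 * pi / p%:R : R) = e_p (t * t^-1) by rewrite mulfV.
  by rewrite e_pM exprM -/(e_p t) et1 expr1n.
move=> /(congr1 (@complex.Re R)) /= c1.
have p2 : 2 <= p%:R :> R by rewrite ler_nat prime_gt1.
have pi0 := pi_gt0 R.
have p0 : 0 < p%:R :> R by apply: lt_le_trans p2; rewrite ltr0n.
suff: 2 * pi / p%:R = 0 :> R.
  by apply/eqP; rewrite gt_eqF // divr_gt0 // mulr_gt0.
apply: cos_inj; rewrite ?c1 ?cos0 // in_itv /= ?lexx ?pi_ge0 //.
by apply/andP; split; rewrite ?ler_pdivrMr ?divr_ge0 //; nra.
Qed.

Lemma sum_e_p s : s != 0 -> \sum_t e_p (s * t) = 0.
Proof.
move=> s0; apply: (@sum_multiplicative_eq0 _ _ +%R _ s^-1); first exact: addrI.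
  by move=> x; rewrite mulrDr e_pD.
by rewrite mulfV // e_p_neq1 // oner_neq0.
Qed.

Lemma chi_prod n (sigma x : 'rV['F_p]_n) :
  chi R sigma x = \prod_j e_p (sigma 0 j * x 0 j).
Proof.
under eq_bigr => j _ do rewrite e_pM.
rewrite prodrXr /chi -cisMn -[_ *+ _ in RHS]mulr_natr natr_sum mulrAC.
by under [in RHS]eq_bigr => j _ do rewrite natrM.
Qed.

Lemma chiC n (sigma x : 'rV['F_p]_n) : chi R sigma x = chi R x sigma.
Proof. by rewrite !chi_prod; apply: eq_bigr => j _; rewrite mulrC. Qed.

Lemma chiDr n (sigma x y : 'rV['F_p]_n) :
  chi R sigma (x + y) = chi R sigma x * chi R sigma y.
Proof.
rewrite !chi_prod -big_split; apply: eq_bigr => j _.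
by rewrite mxE mulrDr e_pD.
Qed.

Lemma chi0r n (sigma : 'rV['F_p]_n) : chi R sigma 0 = 1.
Proof. by rewrite chi_prod big1 // => j _; rewrite mxE mulr0. Qed.

Lemma sqnorm_chi n (sigma x : 'rV['F_p]_n) : sqnorm (chi R sigma x) = 1.
Proof. by rewrite sqnorm_cis. Qed.

Lemma conj_chi n (sigma x : 'rV['F_p]_n) :
  conjc (chi R sigma x) = chi R sigma (- x).
Proof.
have nz : chi R sigma x != 0.
  by rewrite -sqrf_eq0 expf_eq0 -normr_eq0 -sqrf_eq0 normr_sqnorm sqnorm_chi oner_eq0.
apply: (mulfI nz); rewrite -chiDr subrr chi0r -sqr_normc normr_sqnorm.
by rewrite sqnorm_chi.
Qed.

Lemma sum_chi n (x : 'rV['F_p]_n) :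
  \sum_sigma chi R sigma x = if x == 0 then #|{: 'rV['F_p]_n}|%:R else 0.
Proof.
have [->|x0] := eqVneq x 0.
  by under eq_bigr => sigma _ do rewrite chi0r; rewrite sumr_const.
under eq_bigr => sigma _ do rewrite chiC.
have [j xj0] : exists j, x 0 j != 0.
  by apply/rV0Pn.
apply: (@sum_multiplicative_eq0 _ _ +%R _ (delta_mx 0 j)).
- exact: addrI.
- by move=> y; rewrite chiDr.
rewrite chi_prod (bigD1 j) //= big1 => [|i ij].
  by rewrite mulr1 mxE !eqxx mulr1 e_p_neq1.
by rewrite mxE (negbTE ij) andbF mulr0.
Qed.

Lemma card_rV_neq0 n : #|{: 'rV['F_p]_n}|%:R != 0 :> R[i].
Proof. by rewrite pnatr_eq0 -lt0n; apply/card_gt0P; exists 0. Qed.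

Lemma fourier_inversion n (f : 'rV['F_p]_n -> R[i]) x :
  f x = \sum_sigma fourier f sigma * chi R sigma x.
Proof.
rewrite /fourier /expect.
under eq_bigr => sigma _.
  rewrite mulrAC mulr_suml.
  under eq_bigr => y _ do rewrite conj_chi -mulrA -chiDr.
  over.
rewrite -mulr_suml exchange_big (bigD1 x) //= [X in _ + X]big1 => [|y yx].
  by rewrite -mulr_sumr sum_chi addNr eqxx addr0 mulfK // card_rV_neq0.
rewrite -mulr_sumr sum_chi addrC subr_eq0 [x == y]eq_sym (negbTE yx).
by rewrite mulr0.
Qed.

Lemma parseval n (f : 'rV['F_p]_n -> R[i]) :
  \sum_sigma `|fourier f sigma| ^+ 2 = expect (fun x => `|f x| ^+ 2).
Proof.
rewrite /expect.
under [in RHS]eq_bigr => x _ do rewrite sqr_normc [conjc _](congr1 _ (fourier_inversion f x)) rmorph_sum mulr_sumr.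
rewrite exchange_big mulr_suml; apply: eq_bigr => sigma _.
rewrite sqr_normc; set c := conjc _; rewrite /fourier /expect mulrAC.
congr (_ / _); rewrite mulr_suml; apply: eq_bigr => x _.
by rewrite rmorphM -mulrA; congr (_ * _); rewrite mulrC.
Qed.

End Characters.

(** * Moments of functions of low Fourier degree *)

Section LowDegree.
Variables (R : realType) (p n : nat).
Hypothesis p_prime : prime p.

Let tuple_of_row (x : 'rV['F_p]_n) : n.-tuple 'F_p := [tuple x 0 i | i < n].

Let tuple_of_row_bij : bijective tuple_of_row.
Proof.
exists (fun t : n.-tuple 'F_p => \row_i tnth t i) => [x|t].
  by apply/rowP => i; rewrite mxE tnth_mktuple.
by apply: eq_from_tnth => i; rewrite tnth_mktuple mxE.
Qed.

(** Scaling each nontrivial character of one coordinate by [r], the inverse square root of [K],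
    makes the system hypercontractive, and its product system is [r ^+ weight s] times [chi].
    Dividing the coefficients by these scalars costs at most [K ^+ d] in squared norm. *)
Lemma sum_sqnorm_low_degree (d j : nat) (K : R) (a : 'rV['F_p]_n -> R[i]) :
    1 <= K -> (4 * (2 ^ j)%:R + 1) * (p%:R - 1) <= K ->
    (forall sigma, (d < weight sigma)%N -> a sigma = 0) ->
  \sum_x sqnorm (\sum_sigma a sigma * chi R sigma x) ^+ (2 ^ j)
    <= #|{: 'rV['F_p]_n}|%:R * (K ^+ d * \sum_sigma sqnorm (a sigma)) ^+ (2 ^ j).
Proof.
move=> K1 HK a_deg.
have K0 : 0 < K by apply: lt_le_trans K1.
pose r := Num.sqrt K^-1.
have rr : r ^+ 2 = K^-1 by rewrite sqr_sqrtr // invr_ge0 ltW.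
have r0 : r != 0 by rewrite -sqrf_eq0 rr invr_eq0 gt_eqF.
pose phi (s t : 'F_p) : R[i] := (if s == 0 then 1 else r%:C) * e_p R (s * t).
have hyp : hypercontractive (2 ^ j) phi.
  apply: (@hypercontractive_basis _ _ _ 0 _ K^-1) => [||t|s t s0|s s0].
  - by rewrite invr_ge0 ltW.
  - rewrite card_Fp // -[X in _ - X]mul1r -mulrBl natrX mulrA ler_pdivrMr //.
    by rewrite mul1r -natrX.
  - by rewrite /phi eqxx mul0r e_p0 mulr1.
  - by rewrite /phi (negbTE s0) sqnormM sqnorm_real sqnorm_e_p rr mulr1.
  by rewrite /phi (negbTE s0) -mulr_sumr sum_e_p // mulr0.
have phiE (s x : 'rV['F_p]_n) :
    \prod_i phi (tnth (tuple_of_row s) i) (tnth (tuple_of_row x) i)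
      = (r ^+ weight s)%:C * chi R s x.
  rewrite chi_prod // /weight rmorphXn -prodr_const [X in X * _]big_mkcond.
  rewrite -big_split; apply: eq_bigr => i _.
  by rewrite !tnth_mktuple /phi inE; case: eqP.
have [g gK Kg] := tuple_of_row_bij.
pose b t := a (g t) * ((r ^+ weight (g t))^-1)%:C.
have := @hypercontractive_tuple _ _ _ j n phi hyp b.
rewrite card_tuple card_mx mul1n.
rewrite (reindex tuple_of_row) /=; last exact/onW_bij.
rewrite [X in _ * X ^+ _](reindex tuple_of_row) /=; last exact/onW_bij.
under eq_bigr => x _.
  rewrite (reindex tuple_of_row) /=; last exact/onW_bij.
  under eq_bigr => s _.
    rewrite phiE /b gK -mulrA [X in a s * X]mulrA -rmorphM mulVf ?expf_neq0 //.
    rewrite mul1r; over.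
  over.
move/le_trans; apply.
rewrite ler_wpM2l // lerXn2r // ?nnegrE ?mulr_ge0 ?exprn_ge0 ?(ltW K0) //.
- by apply: sumr_ge0 => *; apply: sqnorm_ge0.
- by apply: sumr_ge0 => *; apply: sqnorm_ge0.
rewrite mulr_sumr; apply: ler_sum => s _.
rewrite /b gK sqnormM sqnorm_real exprVn -exprM mulnC exprM rr exprVn invrK.
have [ws|/a_deg ->] := leqP (weight s) d; last first.
  by rewrite /sqnorm /= expr0n addr0 mul0r mulr0.
by rewrite mulrC ler_wpM2r ?sqnorm_ge0 // ler_weXn2l.
Qed.

End LowDegree.

(** * Majorizing sums of products of multiplicative functions *)

(** The sum vanishes unless [phi] is identically 1. *)
Lemma sum_multiplicative_ge0 (C : numFieldType) (T : finType)
    (add : T -> T -> T) (phi : T -> C) :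
    (forall y, injective (add y)) ->
    (forall y x, phi (add y x) = phi y * phi x) ->
  0 <= \sum_x phi x.
Proof.
move=> inj_add phiM; case: (boolP [exists y, phi y != 1]) => [/existsP[y phiy]|].
  by rewrite (sum_multiplicative_eq0 (inj_add y) (phiM y)).
rewrite negb_exists => /forallP phi1; apply: sumr_ge0 => x _.
by have /negPn/eqP -> := phi1 x.
Qed.

(** Expanding the product over choice functions [h], each [h] contributes a product of coefficients
    times the sum of a multiplicative function, which is nonnegative. The triangle inequality then
    applies term by term. *)
Lemma norm_sum_prod_le_majorant (C : numFieldType) (T I J : finType)
    (add : T -> T -> T) (phi : I -> J -> T -> C) (c a : I -> J -> C) :
    (forall y, injective (add y)) ->
    (forall i j y x, phi i j (add y x) = phi i j y * phi i j x) ->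
    (forall i j, `|c i j| <= a i j) ->
  `|\sum_x \prod_i \sum_j c i j * phi i j x|
    <= \sum_x \prod_i \sum_j a i j * phi i j x.
Proof.
move=> inj_add phiM ca.
have E (b : I -> J -> C) : \sum_x \prod_i \sum_j b i j * phi i j x
    = \sum_(h : {ffun I -> J}) (\prod_i b i (h i)) * \sum_x \prod_i phi i (h i) x.
  under eq_bigr => x _ do rewrite bigA_distr_bigA.
  rewrite exchange_big; apply: eq_bigr => h _; rewrite mulr_sumr.
  by apply: eq_bigr => x _; rewrite big_split.
rewrite !E (le_trans (ler_norm_sum _ _ _)) //; apply: ler_sum => h _.
have s0 : 0 <= \sum_x \prod_i phi i (h i) x.
  apply: (sum_multiplicative_ge0 inj_add) => y x.
  by rewrite -big_split; apply: eq_bigr => i _.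
rewrite normrM (ger0_norm s0) ler_wpM2r // normr_prod.
by apply: ler_prod => i _; rewrite normr_ge0 ca.
Qed.

Definition conj_if (R : realType) (b : bool) (z : R[i]) : R[i] :=
  if b then conjc z else z.

Section ConjIf.
Variables (R : realType) (b : bool).
Implicit Types z w : R[i].

Lemma conj_ifM z w : conj_if b (z * w) = conj_if b z * conj_if b w.
Proof. by case: b => //; apply: rmorphM. Qed.

Lemma conj_if_sum (I : finType) (F : I -> R[i]) :
  conj_if b (\sum_i F i) = \sum_i conj_if b (F i).
Proof. by rewrite /conj_if; case: b => //; apply: rmorph_sum. Qed.

Lemma norm_conj_if z : `|conj_if b z| = `|z|.
Proof. by rewrite /conj_if; case: b => //; apply: normcJ. Qed.

Lemma conj_if_real z : 0 <= z -> conj_if b z = z.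
Proof. by rewrite /conj_if; case: b => // z0; apply: geC0_conj. Qed.

End ConjIf.

Lemma conj_if_conj (R : realType) b (z : R[i]) :
  conj_if b (conjc z) = conj_if (~~ b) z.
Proof. by case: b => //=; apply: conjcK. Qed.

(** * Gowers averages as averages over cubes, and their majorants *)

Section Gowers.
Variables (R : realType) (p n : nat).
Notation V := 'rV['F_p]_n.
Implicit Types f : V -> R[i].

(* A mask [s] encodes a subset S of {Y_1, ..., Y_m}. *)
Definition subset_sum m (s : m.-tuple bool) (Y : m.-tuple V) : V :=
  \sum_i tnth Y i *+ tnth s i.

(** Each derivative conjugates the copy of [f] that is not shifted, so conjugations are counted by
    the directions left out of S. *)
Definition sign m (s : m.-tuple bool) : bool := odd (count negb s).

Lemma foldl_mulderiv m f (Y : m.-tuple V) X :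
  foldl (@mulderiv R p n) f Y X
    = \prod_(s : m.-tuple bool) conj_if (sign s) (f (X + subset_sum s Y)).
Proof.
elim: m f Y => [|m IH] f Y.
  by rewrite (tuple0 Y) big_tuple0 /= /subset_sum big_ord0 addr0.
case/tupleP: Y => y Y /=; rewrite IH big_tuple_cons big_bool -big_split /=.
apply: eq_bigr => s _.
have ssE b : subset_sum (cons_tuple b s) [tuple of y :: Y] = y *+ b + subset_sum s Y.
  rewrite /subset_sum big_ord_recl !tnth0; congr (_ + _).
  by apply: eq_bigr => i _; rewrite !tnthS.
have sgE b : sign (cons_tuple b s) = ~~ b (+) sign s by rewrite /sign /= oddD oddb.
rewrite !ssE !sgE /mulderiv conj_ifM conj_if_conj mulr1n mulr0n add0r.
by rewrite [y + _]addrC addrA.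
Qed.

(** A group law under which every function [chi R sigma (X + subset_sum s Y)] of [(X, Y)] is
    multiplicative. *)
Definition pair_add m (u v : V * m.-tuple V) : V * m.-tuple V :=
  (u.1 + v.1, [tuple tnth u.2 i + tnth v.2 i | i < m]).

Lemma pair_add_inj m (u : V * m.-tuple V) : injective (pair_add u).
Proof.
move=> [x X] [y Y] E; have /addrI /= -> := congr1 fst E; congr pair.
apply: eq_from_tnth => i; have := congr1 (fun u => tnth u.2 i) E.
by rewrite !tnth_mktuple => /addrI.
Qed.

Lemma subset_sum_pair_add m (s : m.-tuple bool) (u v : V * m.-tuple V) :
  (pair_add u v).1 + subset_sum s (pair_add u v).2
    = (u.1 + subset_sum s u.2) + (v.1 + subset_sum s v.2).
Proof.
rewrite /= addrACA; congr (_ + _); rewrite /subset_sum -big_split.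
by apply: eq_bigr => i _; rewrite tnth_mktuple mulrnDl.
Qed.

Definition zero_mask m : m.-tuple bool := [tuple of nseq m false].

Lemma subset_sum_zero_mask m (Y : m.-tuple V) : subset_sum (zero_mask m) Y = 0.
Proof.
by rewrite /subset_sum big1 // => i _; rewrite tnth_nseq.
Qed.

(* For [s != 0] the point [subset_sum s Y] is uniformly distributed. *)
Lemma sum_subset_sum (W : pzSemiRingType) m (s : m.-tuple bool) (h : V -> W) :
    s != zero_mask m ->
  #|{: V}|%:R * (\sum_Y h (subset_sum s Y)) = #|{: m.-tuple V}|%:R * \sum_x h x.
Proof.
move=> s0; have [i si] : exists i, tnth s i.
  apply/existsP; apply: contraR s0; rewrite negb_exists => /forallP s0.
  by apply/eqP/eq_from_tnth => i; rewrite tnth_nseq; apply/negbTE.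
rewrite -!sumr_const !mulr_suml.
(* Shifting by [v] one coordinate [i] in S permutes the tuples and moves the subset sum by [v];
   summing over all [v] makes the point run through the whole space. *)
pose sh v (Y : m.-tuple V) := [tuple tnth Y j + v *+ (j == i) | j < m].
have sh_inj v : injective (sh v).
  move=> Y Y' E; apply: eq_from_tnth => j.
  by have /(congr1 (fun t => tnth t j)) := E; rewrite !tnth_mktuple => /addIr.
have shE v Y : subset_sum s (sh v Y) = subset_sum s Y + v.
  rewrite /subset_sum (bigD1 i) //= [in RHS](bigD1 i) //= tnth_mktuple si eqxx.
  rewrite !mulr1n addrAC; congr (_ + _ + _); apply: eq_bigr => j ji.
  by rewrite tnth_mktuple (negbTE ji) mulr0n addr0.
under eq_bigr => v _.
  rewrite mul1r (reindex_inj (sh_inj v)).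
  under eq_bigr => Y _ do rewrite shE.
  over.
rewrite exchange_big; apply: eq_bigr => Y _ /=.
by rewrite mul1r [in RHS](reindex_inj (addrI (subset_sum s Y))).
Qed.

Definition majorant f (x : V) : R[i] :=
  \sum_sigma `|fourier f sigma| * chi R sigma x.

Hypothesis p_prime : prime p.

(* The factor at [s = 0] is majorized by [M] times the full sum of characters,
   which is [#|V|] times the indicator function of 0. *)
Lemma norm_gowers_avg_le m f (M : R[i]) :
    (forall sigma, `|fourier f sigma| <= M) ->
  `|gowers_avg m f| <= M / #|{: m.-tuple V}|%:R *
    \sum_Y \prod_(s : m.-tuple bool | s != zero_mask m)
       `|majorant f (subset_sum s Y)|.
Proof.
move=> fM; have M0 : 0 <= M := le_trans (normr_ge0 _) (fM 0).
pose phi (s : m.-tuple bool) sigma (u : V * m.-tuple V) :=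
  conj_if (sign s) (chi R sigma (u.1 + subset_sum s u.2)).
pose c (s : m.-tuple bool) sigma := conj_if (sign s) (fourier f sigma).
pose a (s : m.-tuple bool) sigma : R[i] :=
  if s == zero_mask m then M else `|fourier f sigma|.
have phiM s sigma u v : phi s sigma (pair_add u v) = phi s sigma u * phi s sigma v.
  by rewrite /phi subset_sum_pair_add chiDr // conj_ifM.
have ca s sigma : `|c s sigma| <= a s sigma.
  by rewrite /a /c norm_conj_if; case: ifP.
have := norm_sum_prod_le_majorant (@pair_add_inj m) phiM ca.
have -> : \sum_u \prod_s \sum_sigma c s sigma * phi s sigma u
    = gowers_avg m f * #|{: V * m.-tuple V}|%:R.
  rewrite /gowers_avg /expect divfK; last first.
    rewrite pnatr_eq0 -lt0n; apply/card_gt0P.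
    by exists (0, [tuple 0 | i < m]).
  apply: eq_bigr => u _; rewrite foldl_mulderiv; apply: eq_bigr => s _.
  rewrite (fourier_inversion p_prime f) conj_if_sum.
  by apply: eq_bigr => sigma _; rewrite conj_ifM.
set T := #|{: m.-tuple V}|.
have T0 : (0 < T%:R :> R[i]).
  by rewrite ltr0n; apply/card_gt0P; exists [tuple 0 | i < m].
have V0 : (0 < #|{: V}|%:R :> R[i]).
  by rewrite lt_def card_rV_neq0 ?ler0n.
pose G Y := \prod_(s : m.-tuple bool | s != zero_mask m)
  conj_if (sign s) (majorant f (subset_sum s Y)).
have -> : \sum_u \prod_s \sum_sigma a s sigma * phi s sigma u
    = M * #|{: V}|%:R * \sum_Y G Y.
  rewrite -(pair_bigA _ (fun X Y =>
    \prod_s \sum_sigma a s sigma * phi s sigma (X, Y))) /=.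
  rewrite exchange_big mulr_sumr; apply: eq_bigr => Y _ /=.
  under eq_bigr => X _.
    rewrite (bigD1 (zero_mask m)) //= {1}/a eqxx /phi /= subset_sum_zero_mask.
    rewrite addr0 -mulr_sumr -conj_if_sum sum_chi //.
    over.
  rewrite (bigD1 0) //= [X in _ + X]big1 => [|X /negbTE ->]; last first.
    by rewrite conj_if_real // mulr0 mul0r.
  rewrite eqxx addr0 conj_if_real ?ltW //; congr (_ * _).
  apply: eq_bigr => s s0; rewrite /majorant conj_if_sum; apply: eq_bigr => sigma _.
  by rewrite /a (negbTE s0) add0r conj_ifM (conj_if_real _ (normr_ge0 _)).
(* The right side dominates a norm, hence is real and at most its own norm; inside that norm the
   conjugations in [G] disappear. *)
move=> H; have {}H := le_trans H (real_ler_norm (ger0_real (le_trans (normr_ge0 _) H))).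
have {}H : `|gowers_avg m f| * T%:R <= M * `|\sum_Y G Y|.
  rewrite -(ler_pM2l V0) mulrCA [leRHS]mulrCA [leRHS]mulrA.
  by move: H; rewrite !normrM !normr_nat card_prod natrM (ger0_norm M0).
rewrite mulrAC ler_pdivlMr // (le_trans H) // ler_wpM2l //.
rewrite (le_trans (ler_norm_sum _ _ _)) //; apply: ler_sum => Y _.
by rewrite normr_prod; apply: ler_prod => s _; rewrite norm_conj_if normr_ge0 lexx.
Qed.

End Gowers.

(** * Upper bound for the Gowers average at low degree *)

Lemma prod_le_mean_exp (C : numFieldType) (I : finType) (e : I -> C) :
    (0 < #|I|)%N -> (forall i, 0 <= e i) ->
  \prod_i e i <= (\sum_i e i ^+ #|I|) / #|I|%:R.
Proof.
move=> I0 e0.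
rewrite -(@ler_pXn2r _ #|I|) ?nnegrE //; first last.
- by rewrite divr_ge0 // sumr_ge0 // => i _; rewrite exprn_ge0.
- by apply: prodr_ge0.
have [H _] := @leif_AGM C I predT (fun i => e i ^+ #|I|) (fun i _ => exprn_ge0 _ (e0 i)).
by move: H; rewrite prodrXl.
Qed.

Lemma norm_expn_sqnorm (R : realType) j (z : R[i]) :
  `|z| ^+ (2 ^ j.+1) = (sqnorm z ^+ (2 ^ j))%:C.
Proof. by rewrite expnS exprM normr_sqnorm rmorphXn. Qed.

(** With the order written [j.+1], the moment of exponent [2 ^ j.+1] of [F] is the moment of
    exponent [2 ^ j] of [sqnorm], as hypercontractivity requires. *)
Lemma norm_gowers_avg_low_degree (R : realType) (p n d j : nat) (K M : R)
    (f : 'rV['F_p]_n -> R[i]) :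
    prime p -> 1 <= K -> (4 * (2 ^ j)%:R + 1) * (p%:R - 1) <= K ->
    fourier_degree_le d f -> expect (fun x => `|f x| ^+ 2) = 1 ->
    (forall sigma, `|fourier f sigma| <= M%:C) ->
  `|gowers_avg j.+1 f| <= (M * K ^+ (d * 2 ^ j))%:C.
Proof.
move=> p_prime K1 HK f_deg f_norm fM.
have M0 : 0 <= M%:C := le_trans (normr_ge0 _) (fM 0).
set D := K ^+ (d * 2 ^ j).
have D1 : 1 <= D%:C by rewrite lecR exprn_ege1.
set V := 'rV['F_p]_n.
pose F := majorant f.
have V0 : (0 < #|{: V}|%:R :> R[i]) by rewrite lt_def card_rV_neq0 ?ler0n.
have momF : \sum_x `|F x| ^+ (2 ^ j.+1) <= #|{: V}|%:R * D%:C.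
  under eq_bigr => x _ do rewrite norm_expn_sqnorm.
  rewrite -rmorph_sum -[#|{: V}|%:R](rmorph_nat (real_complex R)) -rmorphM lecR.
  pose b sigma := `|fourier f sigma|.
  have b_deg sigma : (d < weight sigma)%N -> b sigma = 0.
    by move=> /f_deg; rewrite /b => ->; rewrite normr0.
  apply: (le_trans (sum_sqnorm_low_degree p_prime K1 HK b_deg)).
  have -> : \sum_sigma sqnorm (b sigma) = 1.
    apply: complexI; rewrite rmorph_sum [RHS](_ : _ = 1) // -f_norm -parseval //.
    by apply: eq_bigr => sigma _; rewrite -[LHS]normr_sqnorm normr_id.
  by rewrite mulr1 -exprM.
have cT : #|{: j.+1.-tuple bool}| = (2 ^ j.+1)%N by rewrite card_tuple card_bool.
have q0 : 0 < (2 ^ j.+1)%:R :> R[i] by rewrite ltr0n expn_gt0.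
apply: (le_trans (norm_gowers_avg_le p_prime j.+1 fM)).
rewrite rmorphM -mulrA ler_wpM2l //.
set T := #|{: j.+1.-tuple V}|.
have T0 : (0 < T%:R :> R[i]).
  by rewrite ltr0n; apply/card_gt0P; exists [tuple 0 | i < j.+1].
rewrite mulrC ler_pdivrMr //.
(* A factor 1 at the empty set brings the number of factors to exactly [2 ^ j.+1], so that AM-GM
   produces the moment bounded in [momF]. *)
pose e Y (s : j.+1.-tuple bool) : R[i] :=
  if s == zero_mask j.+1 then 1 else `|F (subset_sum s Y)|.
have eE Y : \prod_(s : j.+1.-tuple bool | s != zero_mask j.+1) `|F (subset_sum s Y)|
    = \prod_s e Y s.
  rewrite [RHS](bigD1 (zero_mask _)) //= {1}/e eqxx mul1r.
  by apply: eq_bigr => s s0; rewrite /e (negbTE s0).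
have e0 Y s : 0 <= e Y s by rewrite /e; case: ifP.
have qn0 : (0 < #|{: j.+1.-tuple bool}|)%N by rewrite cT expn_gt0.
under eq_bigr => Y _ do rewrite eE.
apply: (le_trans (ler_sum _ (fun Y _ => prod_le_mean_exp qn0 (e0 Y)))).
rewrite cT -mulr_suml ler_pdivrMr // exchange_big /=.
have -> : D%:C * T%:R * (2 ^ j.+1)%:R = \sum_(s : j.+1.-tuple bool) T%:R * D%:C.
  by rewrite sumr_const cT -[RHS]mulr_natr [D%:C * _]mulrC.
apply: ler_sum => s _; rewrite /e.
(* The empty set contributes [T], at most [T * D] as [D >= 1]; for any other S the subset sum is
   uniform and [momF] applies. *)
case: eqP => [_|/eqP s0].
  under eq_bigr => Y _ do rewrite expr1n.
  by rewrite sumr_const ler_peMr // ltW.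
rewrite -(ler_pM2l V0) (sum_subset_sum (fun x => `|F x| ^+ (2 ^ j.+1)) s0).
by rewrite mulrCA ler_wpM2l // ltW.
Qed.

(** * The U^2 norm bounds every Fourier coefficient *)

(** For fixed first direction [Y], summing [g (X + Z) * conjc (g X)] over [X] and [Z], with
    [g = mulderiv f Y], gives the squared modulus of the sum of [g]. *)
Lemma gowers_avg2 (R : realType) (p n : nat) (f : 'rV['F_p]_n -> R[i]) :
  gowers_avg 2 f = (\sum_Y sqnorm (\sum_X mulderiv f Y X))%:C
    / #|{: 'rV['F_p]_n}|%:R ^+ 3.
Proof.
rewrite /gowers_avg /expect card_prod card_tuple -expnS natrX; congr (_ / _).
rewrite -(pair_bigA _ (fun X (Y : 2.-tuple _) => foldl (@mulderiv R p n) f Y X)) /=.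
rewrite exchange_big big_tuple_cons /= rmorph_sum; apply: eq_bigr => Y _.
rewrite -[RHS]normr_sqnorm sqr_normc big_tuple_cons.
under eq_bigr => Z _ do rewrite big_tuple0 /=.
rewrite exchange_big rmorph_sum mulr_sumr; apply: eq_bigr => X _ /=.
rewrite -mulr_suml; congr (_ * _).
by rewrite [RHS](reindex_inj (addrI X)).
Qed.

Lemma fourier_le_gowers2 (R : realType) (p n : nat) (f : 'rV['F_p]_n -> R[i])
    (sigma : 'rV['F_p]_n) :
  prime p -> `|fourier f sigma| <= gowers 2 f.
Proof.
move=> p_prime; rewrite /gowers.
set N := #|{: 'rV['F_p]_n}|.
have N0 : (0 < N%:R :> R[i]) by rewrite lt_def card_rV_neq0 ?ler0n.
pose g Y := \sum_X mulderiv f Y X.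
have E : `|fourier f sigma| ^+ 2 * N%:R ^+ 2
    = \sum_Y conjc (chi R sigma Y) * g Y.
  have S_E : fourier f sigma * N%:R = \sum_x f x * conjc (chi R sigma x).
    by rewrite /fourier /expect divfK // gt_eqF.
  have cS (F : 'rV['F_p]_n -> R[i]) : conjc (\sum_x F x) = \sum_x conjc (F x).
    exact: rmorph_sum.
  rewrite -exprMn -[X in _ * X]normr_nat -normrM S_E sqr_normc cS.
  rewrite mulr_sumr.
  under [RHS]eq_bigr => Y _ do rewrite mulr_sumr.
  rewrite [RHS]exchange_big; apply: eq_bigr => X _.
  (* With [x = X + Y], the characters at [X + Y] and [X] combine to the conjugate character at
     [Y]. *)
  rewrite mulr_suml (reindex_inj (addrI X)); apply: eq_bigr => Y _.
  have cc : chi R sigma X * conjc (chi R sigma X) = 1.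
    by rewrite -sqr_normc normr_sqnorm sqnorm_chi.
  have cM : {morph @conjc R : a b / a * b} by move=> a b; apply: rmorphM.
  rewrite /mulderiv chiDr // !cM conjcK.
  transitivity (conjc (chi R sigma Y) * (f (X + Y) * conjc (f X))
     * (chi R sigma X * conjc (chi R sigma X))); first by ring.
  by rewrite cc mulr1.
have le4 : `|fourier f sigma| ^+ 4 <= gowers_avg 2 f.
  (* The additional factor [N] is the one that Cauchy-Schwarz over the [N] values of [Y]
     produces. *)
  rewrite gowers_avg2 ler_pdivlMr ?exprn_gt0 // -(ler_pM2l N0).
  have -> : N%:R * (`|fourier f sigma| ^+ 4 * N%:R ^+ 3)
      = `|\sum_Y conjc (chi R sigma Y) * g Y| ^+ 2.
    rewrite -E [X in _ = X ^+ 2]ger0_norm; last by rewrite mulr_ge0 ?exprn_ge0.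
    by ring.
  rewrite normr_sqnorm -[N%:R](rmorph_nat (real_complex R)) -rmorphM lecR.
  apply: (le_trans (sqnorm_sum_le _ _)).
  by under eq_bigr => Y _ do rewrite sqnormM sqnorm_conj sqnorm_chi mul1r.
have g0 : 0 <= gowers_avg 2 f by apply: le_trans le4; rewrite exprn_ge0.
rewrite -[leLHS](@exprCK _ 4) //.
by rewrite ler_rootC ?nnegrE ?exprn_ge0.
Qed.

Theorem proposition4p1 (R : realType) (p n d k : nat) (eps : R)
    (f : 'rV['F_p]_n -> R[i])
    (p_prime : prime p)
    (f_deg : fourier_degree_le d f)
    (f_norm : l2norm f = 1)
    (k_ge2 : (2 <= k)%N)
    (eps_gt0 : 0 < eps)
    (f_gowers : eps%:C < gowers k f) :
  (exists sigma : 'rV['F_p]_n,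
     ((eps / (2 ^+ k * Num.sqrt (p%:R - 1)) ^+ (3 * d)%N) ^+ (2 ^ k)%N)%:C
       <= `|fourier f sigma|)
  /\
  ((eps / (2 ^+ k * Num.sqrt (p%:R - 1)) ^+ (3 * d)%N) ^+ (2 ^ k)%N)%:C
    <= gowers 2 f.
Proof.
set c := 2 ^+ k * _; set B := (_ / _) ^+ _.
suff [sigma Hs] : exists sigma, B%:C <= `|fourier f sigma|.
  split; first by exists sigma.
  exact: le_trans Hs (fourier_le_gowers2 f sigma p_prime).
case: (boolP [exists sigma, B%:C <= `|fourier f sigma|]) => [/existsP //|].
rewrite negb_exists => /forallP small; exfalso.
have p1 : 1 <= p%:R - 1 :> R by rewrite lerBrDr -(natrD _ 1 1) ler_nat prime_gt1.
have twok : 2 ^+ 2 <= 2 ^+ k :> R by rewrite ler_weXn2l ?ler1n.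
have c1 : 1 <= c.
  have s1 : 1 <= Num.sqrt (p%:R - 1 : R) by rewrite -[leLHS]sqrtr1 ler_wsqrtr.
  by rewrite /c; nra.
have c0 : 0 < c by apply: lt_le_trans c1.
have c2 : c ^+ 2 = (2 ^+ k) ^+ 2 * (p%:R - 1).
  by rewrite exprMn sqr_sqrtr // (le_trans _ p1).
have B_ge0 : 0 <= B by rewrite exprn_ge0 // divr_ge0 ?exprn_ge0 // ltW.
case: k k_ge2 @c @B f_gowers twok c1 c0 c2 B_ge0 small => // j k_ge2 c B.
move=> f_gowers twok c1 c0 c2 B_ge0 small.
have K1 : 1 <= c ^+ 2 by rewrite exprn_ege1.
(* Here [K = c ^+ 2], and the claim reduces to [2 * q + 1 <= q ^+ 2] for [q = 2 ^+ j.+1 >= 4]; this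
   uses [k_ge2]. *)
have HK : (4 * (2 ^ j)%:R + 1) * (p%:R - 1) <= c ^+ 2.
  rewrite c2 ler_wpM2r ?(le_trans _ p1) // natrX.
  by move: twok; rewrite [2 ^+ j.+1]exprS; nra.
have fB sigma : `|fourier f sigma| <= B%:C.
  by rewrite ltW // real_ltNge ?small // ger0_real ?lecR.
have f2 : expect (fun x => `|f x| ^+ 2) = 1.
  by rewrite -[LHS]sqrtCK -/(l2norm f) f_norm expr1n.
have := norm_gowers_avg_low_degree p_prime K1 HK f_deg f2 fB.
apply/negP; rewrite -real_ltNge ?normr_real //; last first.
  by rewrite ger0_real // lecR mulr_ge0 // exprn_ge0 // sqr_ge0.
have q0 : (0 < 2 ^ j.+1)%N by rewrite expn_gt0.
(* [rootCK] holds for every complex number, so nonnegativity of the average is a consequence of this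
   bound, not a prerequisite. *)
have avg_gt : (eps ^+ (2 ^ j.+1))%:C < gowers_avg j.+1 f.
  rewrite -[ltRHS](rootCK q0) rmorphXn ltrXn2r ?lecR ?ltW //.
  by rewrite -lt0n.
have avg_ge0 : 0 <= gowers_avg j.+1 f.
  by apply: le_trans (ltW avg_gt); rewrite lecR exprn_ge0 // ltW.
rewrite ger0_norm //; apply: le_lt_trans avg_gt; rewrite lecR.
(* The bound [B * K ^+ (d * 2 ^ j)] is [B * c ^+ (d * 2 ^ j.+1)], while [B] carries
   [c ^+ (3 * d * 2 ^ j.+1)] in its denominator; as [c >= 1], at most [eps ^+ (2 ^ j.+1)]
   remains. *)
rewrite -exprM mulnCA -expnS.
rewrite /B expr_div_n -mulrA ler_piMr ?exprn_ge0 ?(ltW eps_gt0) //.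
rewrite [leLHS]mulrC ler_pdivrMr ?exprn_gt0 // mul1r -exprM.
by rewrite ler_weXn2l // leq_mul2r leq_pmull ?orbT.
Qed.
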